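(* Let $\alpha>0$ and let $n$ be a positive integer. For a fixed $k\in\{1,2,\dots,n\}$, let $A_k$ be the $n\times n$ diagonal matrix whose $k$-th diagonal entry is $a_{kk}=a+ib$ and whose other diagonal entries are $a_{jj}=1$ for all $j\ne k$, where $a,b\in\mathbb{R}$ and $a^2+b^2\le 1$. Then the Berezin range of the composition operator $C_\phi$ on the Fock space $\mathcal{F}^2_\alpha(\mathbb{C}^n)$ with symbol $\phi(z)=A_kz$ is convex if and only if $b=0$.
   Context: For $\alpha>0$, the Fock space $\mathcal F^2_\alpha(\mathbb C^n)$ is the Hilbert space of holomorphic functions $f$ on $\mathbb C^n$ with $\int_{\mathbb C^n}|f|^2\,dv_\alpha<\infty$, with inner product $\langle f,g\rangle_\alpha=\int_{\mathbb{C}^n} f\overline g\,dv_\alpha$, where $dv_\alpha(z)=(\alpha/\pi)^ne^{-\alpha|z|^2}dv(z)$ is the Gaussian probability measure ($dv$ is Lebesgue volume measure). It is a reproducing kernel Hilbert space with kernel $k_w(z)=e^{\alpha\langle z,w\rangle}$, $\langle z,w\rangle=\sum_{i=1}^nz_i\overline{w_i}$, and $\|k_w\|^2=e^{\alpha|w|^2}$. $C_\phi f=f\circ\phi$. With $\hat k_w=k_w/\|k_w\|$, the Berezin range of a bounded operator $T$ is $\mathrm{Ber}(T)=\{\langle T\hat k_w,\hat k_w\rangle:w\in\mathbb C^n\}\subset\mathbb C$. *)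

(* Defs.v *)
From HB Require Import structures.
From mathcomp Require Import all_boot all_order all_algebra.
From mathcomp Require Import complex ring lra.
From mathcomp Require Import all_classical all_reals all_analysis.
From mathcomp Require Import measurable_realfun.

Set Implicit Arguments.
Unset Strict Implicit.
Unset Printing Implicit Defensive.

Import Order.TTheory GRing.Theory Num.Theory.
Import numFieldNormedType.Exports.

Local Open Scope classical_set_scope.
Local Open Scope ring_scope.
Local Open Scope complex_scope.

(* The product m1 \x m2 packaged with its sigma-finiteness, so that it can be
   iterated. *)
Section prod_measure.
Local Open Scope ereal_scope.
Context {d1 d2} {T1 : measurableType d1} {T2 : measurableType d2}
  {R : realType}.
Variable m1 : {sigma_finite_measure set T1 -> \bar R}.
Variable m2 : {sigma_finite_measure set T2 -> \bar R}.

Definition prod_measure : set (T1 * T2) -> \bar R := m1 \x m2.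

HB.instance Definition _ := Measure.on prod_measure.

Let prod_measure_sigma_finite : sigma_finite setT prod_measure.
Proof.
have /sigma_finiteP[F [TF ndF Foo]] := sigma_finiteT m1.
have /sigma_finiteP[G [TG ndG Goo]] := sigma_finiteT m2.
exists (fun n => F n `*` G n).
  rewrite -setXTT TF TG predeqE => -[x y]; split.
    move=> [/= [n _ Fnx] [k _ Gky]]; exists (maxn n k) => //; split.
    - by move: x Fnx; exact/subsetPset/ndF/leq_maxl.
    - by move: y Gky; exact/subsetPset/ndG/leq_maxr.
  by move=> [n _ []/= ? ?]; split; exists n.
move=> k; have [? ?] := Foo k; have [? ?] := Goo k.
split; first exact: measurableX.
by rewrite /prod_measure product_measure1E// lte_mul_pinfty// ge0_fin_numE.
Qed.

HB.instance Definition _ := Measure_isSigmaFinite.Build _ _ _ prod_measure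
  prod_measure_sigma_finite.

End prod_measure.

Section tuple_measure.
Context {d} {T : measurableType d} {R : realType}.
Variable mu : {sigma_finite_measure set T -> \bar R}.

Definition tuple_cons n (p : T * n.-tuple T) : n.+1.-tuple T :=
  [tuple of p.1 :: p.2].

Lemma measurable_tuple_cons n : measurable_fun [set: T * n.-tuple T] (@tuple_cons n).
Proof. exact: measurable_cons. Qed.

Section cons_measure.
Variables (n : nat) (nu : {sigma_finite_measure set (n.-tuple T) -> \bar R}).

Definition cons_measure : set (n.+1.-tuple T) -> \bar R :=
  pushforward (prod_measure mu nu) (@tuple_cons n).

Let cons_measure0 : cons_measure set0 = 0%E.
Proof. by rewrite /cons_measure /pushforward preimage_set0 measure0. Qed.

Let cons_measure_ge0 A : (0 <= cons_measure A)%E.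
Proof. exact: (measure_ge0 (prod_measure mu nu)). Qed.

Let cons_measure_sigma_additive : semi_sigma_additive cons_measure.
Proof.
move=> F mF tF mUF.
have mc := @measurable_tuple_cons n.
rewrite /cons_measure /pushforward preimage_bigcup.
apply: measure_semi_sigma_additive.
- by move=> i; rewrite -[X in measurable X]setTI; exact: mc.
- apply/trivIsetP => /= i j _ _ ij; rewrite -preimage_setI.
  by move/trivIsetP : tF => /(_ _ _ _ _ ij) ->//; rewrite preimage_set0.
- by rewrite -preimage_bigcup -[X in measurable X]setTI; exact: mc.
Qed.

HB.instance Definition _ := isMeasure.Build _ _ _ cons_measure
  cons_measure0 cons_measure_ge0 cons_measure_sigma_additive.

Let cons_measure_sigma_finite : sigma_finite setT cons_measure.
Proof.
pose uncons (t : n.+1.-tuple T) := (thead t, [tuple of behead t]).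
have muncons : measurable_fun [set: n.+1.-tuple T] uncons.
  by apply/measurable_fun_pair; [exact: measurable_tnth|exact: measurable_behead].
have consK : cancel (@tuple_cons n) uncons.
  by move=> [x t]; rewrite /uncons theadE; congr pair; exact/val_inj.
have [F TF Fi] := sigma_finiteT (prod_measure mu nu).
exists (fun i => uncons @^-1` F i).
  by rewrite -preimage_bigcup -TF preimage_setT.
move=> i; have [mFi Fioo] := Fi i; split.
  by rewrite -[X in measurable X]setTI; exact: muncons.
suff -> : cons_measure (uncons @^-1` F i) = prod_measure mu nu (F i) by [].
rewrite /cons_measure /pushforward -comp_preimage.
by congr prod_measure; apply/seteqP; split => p /=; rewrite consK.
Qed.

HB.instance Definition _ := Measure_isSigmaFinite.Build _ _ _ cons_measure
  cons_measure_sigma_finite.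

End cons_measure.

(* The n-fold product of mu. *)
Fixpoint tuple_measure n : {sigma_finite_measure set (n.-tuple T) -> \bar R} :=
  if n is m.+1 then cons_measure (tuple_measure m) else \d_([tuple] : 0.-tuple T).

Lemma ge0_integral_tuple n (g : 'I_n -> T -> R) :
  (forall i, measurable_fun setT (g i)) -> (forall i x, 0 <= g i x) ->
  (\int[tuple_measure n]_t (\prod_i g i (tnth t i))%:E =
   \prod_(i < n) \int[mu]_x (g i x)%:E)%E.
Proof.
elim: n g => [|n IH] g mg g0 /=.
  under eq_integral do rewrite big_ord0.
  by rewrite integral_dirac// diracT mul1e big_ord0.
have mprod m (h : 'I_m -> T -> R) : (forall i, measurable_fun setT (h i)) ->
    measurable_fun setT (fun t : m.-tuple T => \prod_i h i (tnth t i)).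
  move=> mh; apply: measurable_prod => i _.
  by apply: measurableT_comp; [exact: mh|exact: measurable_tnth].
have h0 m (h : 'I_m -> T -> R) : (forall i x, 0 <= h i x) ->
    forall t : m.-tuple T, (0 <= (\prod_i h i (tnth t i))%:E)%E.
  by move=> hh t; rewrite lee_fin prodr_ge0.
have mG : measurable_fun setT (EFin \o (fun t : n.+1.-tuple T => \prod_i g i (tnth t i))).
  by apply/measurable_EFinP; apply: mprod.
have := ge0_integral_pushforward (@measurable_tuple_cons n)
  (prod_measure mu (tuple_measure n)) measurableT mG (fun t _ => h0 _ g g0 t).
rewrite preimage_setT => -[ ]; rewrite -/(cons_measure (tuple_measure n)) => ->.
rewrite fubini_tonelli1//=; first last.
- by move=> t; exact: h0.
- by apply: (measurableT_comp mG); exact: measurable_tuple_cons.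
pose G (t : n.-tuple T) := \prod_i g (lift ord0 i) (tnth t i).
have G0 t : 0 <= G t by apply: prodr_ge0 => i _.
have mG' : measurable_fun setT (EFin \o G).
  by apply/measurable_EFinP; apply: (mprod _ (fun i => g (lift ord0 i))).
transitivity (\int[mu]_x ((g ord0 x)%:E * \int[tuple_measure n]_t (G t)%:E))%E.
  apply: eq_integral => x _; rewrite /fubini_F/=.
  rewrite -ge0_integralZl//; last by rewrite lee_fin.
    apply: eq_integral => t _; rewrite big_ord_recl EFinM tnth0; congr (_ * _%:E)%E.
    by apply: eq_bigr => i _; rewrite tnthS.
  by move=> t _; rewrite lee_fin.
rewrite ge0_integralZr//.
- by rewrite big_ord_recl -IH.
- exact/measurable_EFinP.
- by move=> x _; rewrite lee_fin.
- by apply: integral_ge0 => t _; rewrite lee_fin.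
Qed.
End tuple_measure.

(* Gives R[i] the norm and topology of a normed space over itself, so that
   differentiability on 'cV[R[i]]_n is complex differentiability. *)
HB.instance Definition _ (R : rcfType) := NormedModule.copy R[i] R[i]^o.

Section expC.
Variable R : realType.
Implicit Types z w : R[i].
Definition expC z : R[i] :=
  (expR (complex.Re z) * cos (complex.Im z)) +i*
  (expR (complex.Re z) * sin (complex.Im z)).

Lemma expCD z w : expC (z + w) = expC z * expC w.
Proof.
case: z => a b; case: w => c d; rewrite /expC/= expRD cosD sinD; simpc.
by congr (_ +i* _); rewrite ?mulrDr ?mulrBr ?mulrN; [congr (_ - _)|rewrite addrC; congr (_ + _)];
  rewrite ?mulrA; congr (_ * _); rewrite -!mulrA; congr (_ * _); rewrite mulrC.
Qed.

Lemma expC_sum n (F : 'I_n -> R[i]) : expC (\sum_i F i) = \prod_i expC (F i).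
Proof.
apply: (big_morph expC expCD).
by rewrite /expC/= expR0 cos0 sin0 mul1r mulr0.
Qed.

Lemma normc_expC z : complex.ComplexField.Normc.normc (expC z) = expR (complex.Re z).
Proof.
rewrite /expC/= !exprMn -mulrDr cos2Dsin2 mulr1 sqrtr_sqr ger0_norm//.
Qed.

Lemma diff1_small (f : R -> R) (df : R) : is_derive (0 : R) (1 : R) f df ->
  forall e, 0 < e -> exists2 del, 0 < del &
    forall x, `|x| < del -> `|f x - f 0 - df * x| <= e * `|x|.
Proof.
move=> [dd dv] e e0.
have : h^-1 *: ((f \o shift 0) h%:A - f 0) @[h --> (0 : R)^'] --> df.
  by rewrite -dv.
move=> /cvgrPdist_lt/(_ e e0) [del/= del0 H]; exists del => // x xdel.
have [->|x0] := eqVneq x 0; first by rewrite !subrr mulr0 subr0 normr0 mulr0.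
have := H x; rewrite /= sub0r normrN => /(_ xdel x0).
rewrite addr0 [_%:A]mulr1 => /ltW; rewrite distrC => h.
have -> : f x - f 0 - df * x = (x^-1 *: (f x - f 0) - df) * x.
  by rewrite mulrBl -[_ *: _]/(_ * _) mulrAC mulVf// mul1r.
by rewrite normrM ler_wpM2r.
Qed.

Let normc := @complex.ComplexField.Normc.normc R.

Lemma normc_le (x y : R) : normc (x +i* y) <= `|x| + `|y|.
Proof.
rewrite /normc/= -[leRHS]ger0_norm ?addr_ge0// -sqrtr_sqr ler_wsqrtr// sqrrD.
by rewrite !real_normK ?num_real// addrAC lerDl mulrn_wge0// mulr_ge0.
Qed.

Lemma normc_ge (x y : R) : (`|x| <= normc (x +i* y)) && (`|y| <= normc (x +i* y)).
Proof.
by rewrite /normc/= -!sqrtr_sqr !ler_wsqrtr ?lerDl ?lerDr ?sqr_ge0.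
Qed.

Lemma expC_small e : 0 < e -> exists2 del, 0 < del & forall z,
  normc z < del -> normc (expC z - 1 - z) <= e * normc z.
Proof.
move=> e0; pose c := e / 7.
have c0 : 0 < c by rewrite divr_gt0.
have [d1 d10 H1] := diff1_small (is_derive_expR (0 : R)) c0.
have [d2 d20 H2] := diff1_small (is_derive_cos (0 : R)) c0.
have [d3 d30 H3] := diff1_small (is_derive_sin (0 : R)) c0.
exists (Num.min (Num.min d1 d2) (Num.min d3 (Num.min 1 c))).
  by rewrite !lt_min d10 d20 d30 c0 ltr01.
case=> x y; rewrite !lt_min => /andP[/andP[n1 n2] /andP[n3 /andP[n4 n5]]].
have /andP[xn yn] := normc_ge x y.
have := H1 x (le_lt_trans xn n1).
have := H2 y (le_lt_trans yn n2).
have := H3 y (le_lt_trans yn n3).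
rewrite expR0 cos0 sin0 oppr0 !mul1r mul0r !subr0 addr0.
set u := sin y - y; set v := cos y - 1; set w := _ - _ - x => hu hv hw.
have x1 : `|x| <= 1 by apply: ltW; exact: le_lt_trans n4.
have yc : `|y| <= c by apply: ltW; exact: le_lt_trans n5.
have -> : expC (x +i* y) - 1 - (x +i* y) =
   (w * cos y + (1 + x) * v) +i* (w * sin y + (1 + x) * u + x * y).
  rewrite /expC/= /w /u /v; simpc.
  by congr (_ +i* _); ring.
apply: (le_trans (normc_le _ _)).
have x2 : `|1 + x| <= 2 by rewrite (le_trans (ler_normD _ _))// normr1 -[leRHS]/(1 + 1) lerD2l.
have A1 : `|w * cos y| <= c * `|x|.
  rewrite normrM -[leRHS]mulr1 ler_pM//.
  by rewrite ler_norml cos_geN1 cos_le1.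
have A2 : `|w * sin y| <= c * `|x|.
  rewrite normrM -[leRHS]mulr1 ler_pM//.
  by rewrite ler_norml sin_geN1 sin_le1.
have A3 : `|(1 + x) * v| <= 2 * (c * `|y|) by rewrite normrM ler_pM.
have A4 : `|(1 + x) * u| <= 2 * (c * `|y|) by rewrite normrM ler_pM.
have A5 : `|x * y| <= c * `|x| by rewrite normrM mulrC ler_wpM2r.
have B1 := ler_normD (w * cos y) ((1 + x) * v).
have B2 := ler_normD (w * sin y + (1 + x) * u) (x * y).
have B3 := ler_normD (w * sin y) ((1 + x) * u).
have C1 : c * `|x| <= c * normc (x +i* y) by rewrite ler_wpM2l// ltW.
have C2 : c * `|y| <= c * normc (x +i* y) by rewrite ler_wpM2l// ltW.
have -> : e = 7 * c by rewrite /c; field.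
lra.
Qed.

Lemma differentiable_expC z : differentiable expC z.
Proof.
apply/derivable1_diffP.
suff H : h^-1 *: ((expC \o shift z) (h *: 1) - expC z) @[h --> (0 : R[i])^'] --> expC z.
  by apply/cvg_ex; exists (expC z).
suff H0 : h^-1 * (expC h - 1) @[h --> (0 : R[i])^'] --> (1 : R[i]).
  rewrite -[X in _ --> X]mul1r.
  under eq_fun => h.
    rewrite /= [h *: 1]mulr1 expCD -[X in _ *: (_ - X)]mul1r -mulrBl scalerAl.
    over.
  exact: cvgMl.
apply/cvgrPdist_le => -[e e'] /=; rewrite ltcE /= => /andP[/eqP-> e0].
have [del del0 H] := expC_small e0.
exists (del%:C); first by rewrite /= ltcR.
move=> h /=; rewrite sub0r normrN => hdel h0.
have -> : 1 - h^-1 * (expC h - 1) = - (h^-1 * (expC h - 1 - h)).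
  by rewrite [in RHS]mulrBr mulVf// opprB.
rewrite normrN normrM normfV ler_pdivrMl ?normr_gt0// mulrC.
have := H h; rewrite -ltcR => /(_ hdel); rewrite -lecR rmorphM; exact.
Qed.
End expC.

Section fock.
Variables (R : realType) (alpha : {posnum R}) (n : nat).
Local Notation Cn := 'cV[R[i]]_n.
Local Notation a := (alpha%:num).
Implicit Types (z w : Cn) (f g : Cn -> R[i]).

(* C^n is identified with (R^2)^n, which carries Lebesgue measure. *)
Definition Cn_of_tuple (x : n.-tuple (measurableTypeR R * measurableTypeR R)) : Cn :=
  \col_j ((tnth x j).1 +i* (tnth x j).2).

Definition volume : {sigma_finite_measure set
    (n.-tuple (measurableTypeR R * measurableTypeR R)) -> \bar R} :=
  tuple_measure (prod_measure lebesgue_measure lebesgue_measure) n.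

Definition dotC z w : R[i] := \sum_i z i 0 * (w i 0)^*.

(* The density of dv_alpha with respect to Lebesgue measure. *)
Definition gauss_density z : R :=
  (a / pi) ^+ n * expR (- a * complex.Re (dotC z z)).

Definition holomorphic f := forall z : Cn, differentiable f z.

Definition square_integrable f :=
  (\int[volume]_x ((Normc.normc (f (Cn_of_tuple x))) ^+ 2 *
                   gauss_density (Cn_of_tuple x))%:E < +oo)%E.

Record fock := Fock {
  fock_fun :> Cn -> R[i];
  fock_holomorphic : holomorphic fock_fun;
  fock_square_integrable : square_integrable fock_fun }.

(* The complex-valued integral against dv_alpha. *)
Definition gauss_integral f : R[i] :=
  (\int[volume]_x (complex.Re (f (Cn_of_tuple x)) * gauss_density (Cn_of_tuple x))) +i*
  (\int[volume]_x (complex.Im (f (Cn_of_tuple x)) * gauss_density (Cn_of_tuple x))).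

Definition inner (f g : fock) : R[i] := gauss_integral (fun z => f z * (g z)^*).

Definition fock_norm (f : fock) : R := Num.sqrt (complex.Re (inner f f)).

Definition kernel_fun w z : R[i] := expC (a%:C * dotC z w).

Lemma scale_kernel_holomorphic c w : holomorphic (fun z => c * kernel_fun w z).
Proof.
move=> z.
have dl : differentiable (fun z : Cn => a%:C * dotC z w) z.
  have -> : (fun z : Cn => a%:C * dotC z w) =
      \sum_(i < n) (fun z : Cn => z i 0 *: (a%:C * (w i 0)^*)).
    apply/funext => x; rewrite fct_sumE mulr_sumr; apply: eq_bigr => i _.
    by rewrite -[_ *: _]/(_ * _) mulrCA.
  apply: differentiable_sum => i; apply: differentiableZl.
  exact: differentiable_coord.
have dk : differentiable (kernel_fun w) z.
  exact: (differentiable_comp dl (@differentiable_expC R _)).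
exact: (differentiableZ c dk).
Qed.

Lemma gauss_fin (b : R) :
  (\int[@lebesgue_measure R]_x (expR (b * x - a * x ^+ 2))%:E < +oo)%E.
Proof.
pose s := Num.sqrt ((2 * a)^-1); pose m := b / (2 * a).
have a0 : a != 0 by [].
have s2 : s ^+ 2 = (2 * a)^-1 by rewrite sqr_sqrtr// invr_ge0.
have s0 : s != 0 by rewrite gt_eqF// sqrtr_gt0 invr_gt0.
pose K := expR (b ^+ 2 / (4 * a)) / normal_peak s.
have K0 : 0 <= K by rewrite divr_ge0 ?expR_ge0// normal_peak_ge0.
rewrite (_ : (fun x => _) = (fun x => K%:E * (normal_pdf m s x)%:E)%E).
  rewrite ge0_integralZl//.
  - by rewrite integral_normal_pdf// mule1 ltry.
  - by apply/measurable_EFinP; exact: measurable_normal_pdf.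
  - by move=> x _; rewrite lee_fin normal_pdf_ge0.
apply/funext => x; rewrite -EFinM /normal_pdf (negbTE s0) /K; congr EFin.
have p0 : normal_peak s != 0 by rewrite gt_eqF// normal_peak_gt0.
rewrite [RHS]mulrA divfK// /normal_fun -expRD s2 /m; congr expR.
by field.
Qed.

Lemma gauss2_fin (b c : R) :
  (\int[prod_measure (@lebesgue_measure R) (@lebesgue_measure R)]_p
     (a / pi * (expR (b * p.1 - a * p.1 ^+ 2) * expR (c * p.2 - a * p.2 ^+ 2)))%:E
   \is a fin_num)%E.
Proof.
have me u : measurable_fun [set: measurableTypeR R] (fun x => expR (u * x - a * x ^+ 2)).
  by apply: measurableT_comp => //; apply: measurable_funB => //;
    apply: measurable_funM => //; exact: measurable_funX.
have e0 u : (0 <= \int[@lebesgue_measure R]_x (expR (u * x - a * x ^+ 2))%:E)%E.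
  by apply: integral_ge0 => x _; rewrite lee_fin expR_ge0.
have ef u : (\int[@lebesgue_measure R]_x (expR (u * x - a * x ^+ 2))%:E \is a fin_num)%E.
  by rewrite ge0_fin_numE// gauss_fin.
have ap : 0 <= a / pi by rewrite divr_ge0// pi_ge0.
rewrite fubini_tonelli1//=; first last.
- by move=> x; rewrite lee_fin mulr_ge0// mulr_ge0// expR_ge0.
- apply/measurable_EFinP; apply: measurable_funM => //.
  by apply: measurable_funM;
    [exact: (measurableT_comp (me _) measurable_fst)
    |exact: (measurableT_comp (me _) measurable_snd)].
under eq_integral => x _.
  rewrite (_ : fubini_F _ _ x = (a / pi * expR (b * x - a * x ^+ 2))%:E *
     \int[@lebesgue_measure R]_y (expR (c * y - a * y ^+ 2))%:E)%E; last first.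
    rewrite /fubini_F/= -ge0_integralZl//.
    - by apply: eq_integral => y _; rewrite -EFinM mulrA.
    - exact/measurable_EFinP.
    - by rewrite lee_fin mulr_ge0 ?expR_ge0.
  over.
rewrite ge0_integralZr//=; first last.
- by move=> y _; rewrite lee_fin mulr_ge0 ?expR_ge0.
- by apply/measurable_EFinP; apply: measurable_funM.
rewrite fin_numM//.
under eq_integral do rewrite EFinM.
rewrite ge0_integralZl//.
- by rewrite fin_numM.
- exact/measurable_EFinP.
Qed.

Let Re_sum (F : 'I_n -> R[i]) : complex.Re (\sum_i F i) = \sum_i complex.Re (F i).
Proof. by apply: (big_morph (@complex.Re R)) => // -[? ?] [? ?]. Qed.

Lemma scale_kernel_square_integrable c w :
  square_integrable (fun z => c * kernel_fun w z).
Proof.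
pose g (j : 'I_n) (p : measurableTypeR R * measurableTypeR R) : R :=
  let u := complex.Re (w j 0) in let v := complex.Im (w j 0) in
  a / pi * (expR (2 * a * u * p.1 - a * p.1 ^+ 2) *
            expR (2 * a * v * p.2 - a * p.2 ^+ 2)).
have me u : measurable_fun [set: measurableTypeR R]
    (fun x => expR (u * x - a * x ^+ 2)).
  by apply: measurableT_comp => //; apply: measurable_funB => //;
    apply: measurable_funM => //; exact: measurable_funX.
have mg j : measurable_fun setT (g j).
  apply: measurable_funM => //.
  by apply: measurable_funM;
    [exact: (measurableT_comp (me _) measurable_fst)
    |exact: (measurableT_comp (me _) measurable_snd)].
have g0 j p : 0 <= g j p.
  by rewrite /g mulr_ge0 ?divr_ge0 ?pi_ge0// mulr_ge0// expR_ge0.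
rewrite /square_integrable.
under eq_integral => x _.
  rewrite (_ : (_ * _)%:E = (Normc.normc c ^+ 2)%:E *
      (\prod_j g j (tnth x j))%:E)%E; last first.
    rewrite -EFinM Normc.normcM exprMn -mulrA; congr (_ * _)%:E.
    rewrite normc_expC -expRM_natl /gauss_density mulrCA -expRD.
    rewrite big_split/= prodr_const card_ord; congr (_ * _).
    under eq_bigr do rewrite -expRD.
    rewrite -expR_sum; congr expR.
    have ReM (t : R) (u : R[i]) : complex.Re (t%:C * u) = t * complex.Re u.
      by case: u => p q /=; rewrite mul0r subr0.
    rewrite ReM !Re_sum !mulr_sumr -big_split/=; apply: eq_bigr => j _.
    rewrite !mxE; case: (w j 0) => p q; case: (tnth x j) => r s /=.
    by rewrite !mulrN !opprK; ring.
  over.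
rewrite ge0_integralZl//=; first last.
- by rewrite lee_fin sqr_ge0.
- by move=> x _; rewrite lee_fin prodr_ge0.
- apply/measurable_EFinP; apply: measurable_prod => j _.
  exact: (measurableT_comp (mg j) (measurable_tnth j)).
rewrite ge0_integral_tuple//.
suff : (\prod_(i < n) \int[prod_measure lebesgue_measure lebesgue_measure]_x (g i x)%:E)%E
    \is a fin_num.
  by move=> /fineK <-; rewrite -EFinM ltry.
by elim/big_ind : _ => // [x y xf yf|j _]; [exact: fin_numM|exact: gauss2_fin].
Qed.

Lemma kernel_holomorphic w : holomorphic (kernel_fun w).
Proof.
rewrite (_ : kernel_fun w = (fun z => 1 * kernel_fun w z)).
  exact: scale_kernel_holomorphic.
by apply/funext => z; rewrite mul1r.
Qed.

Lemma kernel_square_integrable w : square_integrable (kernel_fun w).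
Proof.
rewrite (_ : kernel_fun w = (fun z => 1 * kernel_fun w z)).
  exact: scale_kernel_square_integrable.
by apply/funext => z; rewrite mul1r.
Qed.

Definition kernel w : fock :=
  Fock (kernel_holomorphic w) (kernel_square_integrable w).

Definition normalized_kernel w : fock := Fock
  (scale_kernel_holomorphic ((fock_norm (kernel w))^-1)%:C w)
  (scale_kernel_square_integrable ((fock_norm (kernel w))^-1)%:C w).

Lemma zero_holomorphic : holomorphic (fun=> 0).
Proof. by move=> z; exact: differentiable_cst. Qed.

Lemma zero_square_integrable : square_integrable (fun=> 0).
Proof.
rewrite /square_integrable; under eq_integral do rewrite Normc.normc0 expr0n mul0r.
by rewrite integral0.
Qed.

Definition zero_fock : fock := Fock zero_holomorphic zero_square_integrable.

(* When f \o phi is not in the Fock space, C_phi is undefined at f and the value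
   here is 0. This never happens for bounded C_phi, in particular for phi z = A z
   with A of operator norm at most 1. *)
Definition composition_operator (phi : Cn -> Cn) (f : fock) : fock :=
  if pselect (holomorphic (f \o phi) /\ square_integrable (f \o phi)) is left h
  then Fock (proj1 h) (proj2 h) else zero_fock.

Definition berezin_range (T : fock -> fock) : set R[i] :=
  [set inner (T (normalized_kernel w)) (normalized_kernel w) | w in [set: Cn]].

End fock.

Arguments composition_operator {R} alpha {n} phi f.

(* Main.v *)
Require Import Defs.
From mathcomp Require Import all_boot all_order all_algebra complex ring lra.
From mathcomp Require Import all_classical all_reals all_analysis measurable_realfun.

Set Implicit Arguments.
Unset Strict Implicit.
Unset Printing Implicit Defensive.

Import Order.TTheory GRing.Theory Num.Theory.
Import numFieldNormedType.Exports.

Local Open Scope classical_set_scope.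
Local Open Scope ring_scope.
Local Open Scope complex_scope.

(** The Berezin range is the image of an explicit curve, and convexity is read
    off from that curve.

    The point is that composing with a linear map acts on kernels by its
    adjoint: since <Az, w> = <z, A* w>, the function k_w(Az) is k_{A* w}(z).
    The reproducing property <k_v, k_w> = k_v(w) then gives
      <C_A k_w, k_w> / ||k_w||^2 = exp (alpha (<Aw, w> - |w|^2)).
    For the diagonal matrix with entry l at k and 1 elsewhere, the exponent is
    alpha (l - 1) |w_k|^2, and alpha |w_k|^2 takes every value in [0, +oo[.
    Hence the range is the curve { exp ((l - 1) r) : r >= 0 }
    ([berezin_range_diag]).

    If b = Im l is nonzero the curve is a spiral: it contains 1 (at r = 0) and
    a negative real (at r = pi / |b|), so a convex set containing it contains
    0, which the exponential never reaches. If b = 0 the curve stays on the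
    positive reals, where it is an interval with endpoint 1, possibly reduced
    to {1} ([convex_expC_ray]).

    The reproducing property for kernels ([gauss_integral_kernel]) is proved by
    direct integration. The integrand is a product over coordinates, and over
    real and imaginary parts, of one-dimensional complex Gaussians, so Fubini
    ([cintegral_mul_prod], [cintegral_prod_tuple]) reduces it to
      int exp (A x - a x^2) dx = sqrt (pi / a) exp (A^2 / (4 a)), A complex
    ([cintegral_gaussian]). Completing the square in the real part of A leaves
    the Fourier transform of exp (- c x^2), determined by the differential
    equation F'(t) = - t / (2 c) F(t) ([is_derive_gaussian_cos]), which comes
    from differentiation under the integral and integration by parts. *)

(** * Real Gaussians and their integrability *)

Section gaussian.
Variable R : realType.
Implicit Types b m t x : R.
Local Notation mu := (@lebesgue_measure R).

Definition gaussian b m x : R := expR (- b * (x - m) ^+ 2).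

Lemma gaussian_pdf b m : 0 < b ->
  gaussian b m = (fun x => Num.sqrt (pi / b) * normal_pdf m (Num.sqrt ((2 * b)^-1)) x).
Proof.
move=> b0; apply/funext => x; set s := Num.sqrt ((2 * b)^-1).
have s2 : s ^+ 2 *+ 2 = b^-1.
  rewrite sqr_sqrtr ?invr_ge0 ?mulr_ge0 ?(ltW b0)// -[LHS]mulr_natr.
  by field; rewrite gt_eqF.
have s0 : s != 0 by rewrite gt_eqF// sqrtr_gt0 invr_gt0 mulr_gt0.
rewrite normal_pdfE// /normal_peak /normal_fun.
rewrite /gaussian -mulrnAl s2 [b^-1 * pi]mulrC mulVKf; last first.
  by rewrite gt_eqF// sqrtr_gt0 divr_gt0// pi_gt0.
by rewrite invrK mulNr mulrC mulNr.
Qed.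

Lemma measurable_gaussian b m : measurable_fun [set: R] (gaussian b m).
Proof.
apply: measurableT_comp => //; apply: measurable_funM => //.
by apply: measurable_funX; exact: measurable_funB.
Qed.

Lemma integrable_gaussian b m : 0 < b ->
  mu.-integrable [set: R] (EFin \o gaussian b m).
Proof.
move=> b0; rewrite gaussian_pdf//.
exact: (integrableZl measurableT _ (integrable_normal_pdf _ _)).
Qed.

Lemma Rintegral_gaussian b m : 0 < b ->
  \int[mu]_x gaussian b m x = Num.sqrt (pi / b).
Proof.
move=> b0; rewrite gaussian_pdf// RintegralZl//; last exact: integrable_normal_pdf.
by rewrite /Rintegral integral_normal_pdf/= mulr1.
Qed.

(** A linear factor costs only a widening of the Gaussian; halving the
    exponent gives an integrable bound that also serves as the dominating
    function when differentiating in the frequency. *)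
Lemma norm_mul_gaussian b m x : 0 < b ->
  `|x - m| * gaussian b m x <= (1 + 2 / b) * gaussian (b / 2) m x.
Proof.
move=> b0; rewrite /gaussian; set y := x - m.
have -> : expR (- b * y ^+ 2) = expR (- (b / 2) * y ^+ 2) * expR (- (b / 2 * y ^+ 2)).
  by rewrite -expRD; congr expR; field.
rewrite mulrCA mulrC ler_wpM2r ?expR_ge0// expRN ler_pdivrMr ?expR_gt0//.
have E : 1 + b / 2 * y ^+ 2 <= expR (b / 2 * y ^+ 2) by exact: expR_ge1Dx.
have b2 : 0 < 2 / b by rewrite divr_gt0.
apply: (@le_trans _ _ ((1 + 2 / b) * (1 + b / 2 * y ^+ 2))); last first.
  by rewrite ler_wpM2l// addr_ge0// ltW.
have -> : (1 + 2 / b) * (1 + b / 2 * y ^+ 2) = 1 + 2 / b + b / 2 * y ^+ 2 + y ^+ 2.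
  by field; rewrite gt_eqF.
have bp : 0 < b / 2 by rewrite divr_gt0.
rewrite -[y ^+ 2]real_normK ?num_real//.
(* after dropping nonnegative terms, |y| <= 1 + y^2 remains *)
have := mulr_ge0 (ltW bp) (sqr_ge0 `|y|); have := sqr_ge0 (`|y| - 1 / 2).
move: (b / 2 * _) (2 / b) b2 => p q q0; rewrite sqrrB; lra.
Qed.

Lemma integrable_le_gaussian (f : R -> R) b m : 0 < b -> measurable_fun [set: R] f ->
  (exists2 K, 0 <= K & forall x, `|f x| <= K * gaussian b m x) ->
  mu.-integrable [set: R] (EFin \o f).
Proof.
move=> b0 mf [K K0 H].
apply: (le_integrable measurableT _ _
  (integrableZl measurableT K (integrable_gaussian m b0))).
  exact/measurable_EFinP.
move=> x _ /=; rewrite lee_fin (le_trans (H x))//.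
by rewrite -[leLHS]ger0_norm// mulr_ge0// expR_ge0.
Qed.

Lemma cvg_itv_Rintegral (f : R -> R) : mu.-integrable [set: R] (EFin \o f) ->
  (\int[mu]_(x in `[- n%:R, n%:R]) f x) @[n --> \oo] --> \int[mu]_x f x.
Proof.
move=> fi; have /integrableP[mf _] := fi.
pose fn (n : nat) : R -> \bar R := (EFin \o f) \_ `[- n%:R, n%:R].
have mn n : measurable_fun [set: R] (fn n).
  by apply/(measurable_restrictT _ _).1 => //; exact: measurable_funS mf.
have cvf : {ae mu, forall x, [set: R] x -> fn ^~ x @ \oo --> (EFin \o f) x}.
  apply: aeW => x _; apply: cvg_near_cst.
  near=> n; rewrite /fn patchE mem_set//= in_itv/= -ler_norml.
  by near: n; exact: nbhs_infty_ger.
have dom : {ae mu, forall x n, [set: R] x -> (`|fn n x| <= (abse \o (EFin \o f)) x)%E}.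
  by apply: aeW => x n _; rewrite /fn patchE; case: ifP => // _; rewrite abse0 abse_ge0.
have [_ _] := @dominated_convergence _ _ _ mu _ measurableT _ _ _ mn mf cvf
  (integrable_abse fi) dom.
rewrite -(fineK (integrable_fin_num measurableT fi)) => /fine_cvg.
apply: cvg_trans; apply: near_eq_cvg; near=> n.
by rewrite /= /Rintegral integral_mkcond.
Unshelve. all: end_near. Qed.

(** Integration by parts on the whole line in the form it is used below: the
    fundamental theorem of calculus on [-n, n], with n going to infinity. *)
Lemma Rintegral_derive_eq0 (F f : R -> R) :
  (forall x, is_derive x 1 F (f x)) -> continuous f ->
  mu.-integrable [set: R] (EFin \o f) ->
  F n%:R @[n --> \oo] --> (0 : R) -> F (- n%:R) @[n --> \oo] --> (0 : R) ->
  \int[mu]_x f x = 0.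
Proof.
move=> dF cf fi Fy FNy.
have /cvg_lim <- // := cvg_itv_Rintegral fi.
apply/cvg_lim => //; rewrite -(subr0 0).
apply: cvg_trans (cvgB Fy FNy); apply: near_eq_cvg; near=> n.
have n0 : (0 : R) < n%:R by near: n; exact: nbhs_infty_gtr.
have dbl x : derivable F x 1 by [].
have cF : continuous F.
  by move=> x; exact/differentiable_continuous/derivable1_diffP.
rewrite /Rintegral (@continuous_FTC2 _ f F)//.
- by rewrite -subr_gt0 opprK addr_gt0.
- exact: continuous_subspaceT.
- split=> //; first by apply: cvg_at_right_filter; exact: cF.
  by apply: cvg_at_left_filter; exact: cF.
- by move=> x _; rewrite derive1E derive_val.
Unshelve. all: end_near. Qed.

End gaussian.

(** * The Fourier transform of a Gaussian *)

Section gaussian_fourier.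
Variable R : realType.
Implicit Types b m t phi x : R.
Local Notation mu := (@lebesgue_measure R).

Lemma measurable_phase (h : R -> R) t m phi : measurable_fun [set: R] h ->
  measurable_fun [set: R] (fun x => h (t * (x - m) + phi)).
Proof.
move=> mh; apply: measurableT_comp => //; apply: measurable_funD => //.
by apply: measurable_funM => //; exact: measurable_funB.
Qed.

Lemma norm_cos_le1 x : `|cos x| <= 1.
Proof. by rewrite ler_norml cos_geN1 cos_le1. Qed.

Lemma norm_sin_le1 x : `|sin x| <= 1.
Proof. by rewrite ler_norml sin_geN1 sin_le1. Qed.

Lemma integrable_gaussian_bounded b m (h : R -> R) : 0 < b ->
  measurable_fun [set: R] h -> (forall x, `|h x| <= 1) ->
  mu.-integrable [set: R] (EFin \o (fun x => gaussian b m x * h x)).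
Proof.
move=> b0 mh h1; apply: (integrable_le_gaussian (m := m) b0).
  by apply: measurable_funM => //; exact: measurable_gaussian.
exists 1 => // x; rewrite mul1r normrM ger0_norm ?expR_ge0//.
by rewrite ler_piMr ?expR_ge0.
Qed.

Lemma integrable_mul_gaussian_bounded b m (h : R -> R) : 0 < b ->
  measurable_fun [set: R] h -> (forall x, `|h x| <= 1) ->
  mu.-integrable [set: R] (EFin \o (fun x => (x - m) * gaussian b m x * h x)).
Proof.
move=> b0 mh h1; apply: (integrable_le_gaussian (b := b / 2) (m := m)).
- by rewrite divr_gt0.
- by do 2 apply: measurable_funM => //; [exact: measurable_funB|exact: measurable_gaussian].
exists (1 + 2 / b); first by rewrite addr_ge0// divr_ge0// ltW.
move=> x; rewrite !normrM (ger0_norm (expR_ge0 _)).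
apply: le_trans (norm_mul_gaussian m x b0).
by rewrite ler_piMr// mulr_ge0// expR_ge0.
Qed.

Lemma is_derive_phase_cos t m phi x :
  is_derive t 1 (fun t => cos (t * (x - m) + phi)) (- (x - m) * sin (t * (x - m) + phi)).
Proof.
by apply: is_derive_eq; rewrite /GRing.scale/=; ring.
Qed.

Lemma is_derive_gaussian b m x :
  is_derive x 1 (gaussian b m) (- (2 * b) * ((x - m) * gaussian b m x)).
Proof.
rewrite /gaussian; apply: is_derive_eq; rewrite /GRing.scale/=; ring.
Qed.

(** The sequences n and -n are treated at once: only |u n| = n matters. The
    rate is read off from [norm_mul_gaussian], which bounds the Gaussian by a
    constant over |u n - m|. *)
Lemma cvg_gaussian_bounded b m (h : R -> R) (u : R^nat) : 0 < b ->
  (forall x, `|h x| <= 1) -> (forall n, `|u n| = n%:R) ->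
  gaussian b m (u n) * h (u n) @[n --> \oo] --> (0 : R).
Proof.
move=> b0 h1 un; apply/cvgr0Pnorm_le => e e0; near=> n.
have K0 : 0 < 1 + 2 / b by rewrite addr_gt0// divr_gt0.
rewrite normrM (le_trans (ler_piMr _ (h1 _)))// ger0_norm ?expR_ge0//.
have : (1 + 2 / b) / e <= `|u n - m|.
  apply: le_trans (lerB_dist _ _); rewrite un lerBrDr.
  by near: n; exact: nbhs_infty_ger.
move=> /(ler_wpM2r (expR_ge0 (- b * (u n - m) ^+ 2))) H.
have := le_trans H (norm_mul_gaussian m (u n) b0).
rewrite -mulrA ler_pM2l// => /le_trans H1.
suff : e^-1 * gaussian b m (u n) <= 1 by rewrite ler_pdivrMl// mulr1.
apply: H1; rewrite -expR0 ler_expR mulNr oppr_le0 mulr_ge0 ?sqr_ge0//.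
by rewrite divr_ge0// ltW.
Unshelve. all: end_near. Qed.

(** The difference of the two sides is the integral of the derivative of
    gaussian b m x * sin (t * (x - m) + phi). *)
Lemma gaussian_parts b m t phi : 0 < b ->
  2 * b * (\int[mu]_x ((x - m) * gaussian b m x * sin (t * (x - m) + phi))) =
  t * \int[mu]_x (gaussian b m x * cos (t * (x - m) + phi)).
Proof.
move=> b0; set S := \int[mu]_x _; set C := \int[mu]_x _.
have iS := integrable_mul_gaussian_bounded m b0
  (measurable_phase t m phi (continuous_measurable_fun (@continuous_sin R))) (fun x => norm_sin_le1 (t * (x - m) + phi)).
have iC := integrable_gaussian_bounded m b0
  (measurable_phase t m phi (continuous_measurable_fun (@continuous_cos R))) (fun x => norm_cos_le1 (t * (x - m) + phi)).
pose f x := t * (gaussian b m x * cos (t * (x - m) + phi)) -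
  2 * b * ((x - m) * gaussian b m x * sin (t * (x - m) + phi)).
have fE : EFin \o f =
   (fun x => (t * (gaussian b m x * cos (t * (x - m) + phi)))%:E -
     (2 * b * ((x - m) * gaussian b m x * sin (t * (x - m) + phi)))%:E)%E by [].
have iC' := integrableZl measurableT t iC.
have iS' := integrableZl measurableT (2 * b) iS.
suff : \int[mu]_x f x = 0.
  rewrite RintegralB// !RintegralZl// => /eqP; rewrite subr_eq0 => /eqP ->//.
apply: (@Rintegral_derive_eq0 _ (fun x => gaussian b m x * sin (t * (x - m) + phi))).
- move=> x; have dg := is_derive_gaussian b m x.
  by rewrite /f; apply: is_derive_eq; rewrite /GRing.scale/=; ring.
- move=> x; have dg := is_derive_gaussian b m x.
  have df : derivable f x 1 by apply: ex_derive.
  exact/differentiable_continuous/derivable1_diffP.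
- by rewrite fE; exact: (integrableB measurableT iC' iS').
- apply: (@cvg_gaussian_bounded b m (fun x => sin (t * (x - m) + phi)) (fun n => n%:R)) => // [x|n]; first exact: norm_sin_le1.
  by rewrite ger0_norm.
- apply: (@cvg_gaussian_bounded b m (fun x => sin (t * (x - m) + phi)) (fun n => - n%:R)) => // [x|n]; first exact: norm_sin_le1.
  by rewrite normrN ger0_norm.
Qed.

(** Differentiating under the integral brings down a factor x - m, which
    [gaussian_parts] trades for t / (2 b). *)
Lemma is_derive_gaussian_cos b m t phi : 0 < b ->
  is_derive t 1 (fun t => \int[mu]_x (gaussian b m x * cos (t * (x - m) + phi)))
    (- (t / (2 * b)) * \int[mu]_x (gaussian b m x * cos (t * (x - m) + phi))).
Proof.
move=> b0.
pose f (t x : R) := gaussian b m x * cos (t * (x - m) + phi).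
have df (s x : R) : is_derive s 1 (f ^~ x) (- ((x - m) * gaussian b m x * sin (s * (x - m) + phi))).
  have dc := is_derive_phase_cos s m phi x.
  by apply: is_derive_eq; rewrite /GRing.scale/=; ring.
have pf (s x : R) : partial1of2 f s x = - ((x - m) * gaussian b m x * sin (s * (x - m) + phi)).
  by rewrite partial1of2E derive_val.
have It : (`]t - 1, t + 1[%classic : set R) t.
  by rewrite /= in_itv/= ltrBlDr ltrDl ltr01.
have fi x : (`]t - 1, t + 1[%classic : set R) x ->
    mu.-integrable [set: R] (EFin \o f x).
  move=> _; apply: integrable_gaussian_bounded => //; last by move=> y; exact: norm_cos_le1.
  exact: (measurable_phase _ _ _ (continuous_measurable_fun (@continuous_cos R))).
have db x y : (`]t - 1, t + 1[%classic : set R) x -> [set: R] y -> derivable (f ^~ y) x 1.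
  by move=> _ _; apply: ex_derive; exact: df.
pose K := 1 + 2 / b.
pose G x := K * gaussian (b / 2) m x.
have K0 : 0 <= K by rewrite addr_ge0// divr_ge0// ltW.
have G0 x : 0 <= G x by rewrite mulr_ge0// expR_ge0.
have bp : 0 < b / 2 by rewrite divr_gt0.
have iG : mu.-integrable [set: R] (EFin \o G).
  exact: (integrableZl measurableT K (integrable_gaussian m bp)).
have ub x y : (`]t - 1, t + 1[%classic : set R) x -> [set: R] y -> `|partial1of2 f x y| <= G y.
  move=> _ _; rewrite pf normrN !normrM (ger0_norm (expR_ge0 _)).
  apply: le_trans (norm_mul_gaussian m y b0).
  by rewrite ler_piMr ?norm_sin_le1// mulr_ge0// expR_ge0.
apply: DeriveDef; first exact: (derivable_under_integral measurableT It fi db G0 iG ub).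
rewrite -derive1E (differentiation_under_integral measurableT It fi db G0 iG ub).
under eq_Rintegral do rewrite pf -mulN1r.
rewrite RintegralZl//; last first.
  exact: (integrable_mul_gaussian_bounded m b0
    (measurable_phase t m phi (continuous_measurable_fun (@continuous_sin R)))
    (fun x => norm_sin_le1 (t * (x - m) + phi))).
have := gaussian_parts m t phi b0 => /(congr1 (fun z => (2 * b)^-1 * z)).
have bn : 2 * b != 0 by rewrite mulf_neq0// gt_eqF.
rewrite mulKf// => ->.
by rewrite mulN1r mulNr mulrA [t / _]mulrC.
Qed.

(** The phase phi makes one formula cover cosine and sine transforms, and
    absorbs the recentering at m. *)
Lemma Rintegral_gaussian_cos b m t phi : 0 < b ->
  \int[mu]_x (gaussian b m x * cos (t * (x - m) + phi)) =
  Num.sqrt (pi / b) * (expR (- (t ^+ 2 / (4 * b))) * cos phi).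
Proof.
move=> b0; pose G s := \int[mu]_x (gaussian b m x * cos (s * (x - m) + phi)).
(* dividing by the expected solution of the differential equation leaves a constant *)
pose P s := expR (s ^+ 2 / (4 * b)) * G s.
have bn : b != 0 by rewrite gt_eqF.
have dP (s : R) : is_derive s 1 P 0.
  have dG := @is_derive_gaussian_cos b m s phi b0.
  by apply: is_derive_eq; rewrite /GRing.scale/= -/(G s); field.
have := is_derive_0_is_cst t 0 dP.
rewrite /P expr0n/= mul0r expR0 mul1r /G.
under [X in _ = X -> _]eq_Rintegral do rewrite mul0r add0r.
rewrite RintegralZr//; last exact: integrable_gaussian.
rewrite Rintegral_gaussian// => H.
by rewrite expRN mulrCA -H mulKf// gt_eqF// expR_gt0.
Qed.

End gaussian_fourier.

(** * Complex-valued integrals *)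

Section complex_integral.
Context {d} {T : measurableType d} {R : realType}.
Variable mu : {measure set T -> \bar R}.
Implicit Type f : T -> R[i].

Definition cintegrable f :=
  mu.-integrable [set: T] (EFin \o (fun x => complex.Re (f x))) /\
  mu.-integrable [set: T] (EFin \o (fun x => complex.Im (f x))).

Definition cintegral f : R[i] :=
  (\int[mu]_x complex.Re (f x)) +i* (\int[mu]_x complex.Im (f x)).

Lemma cintegralZl c f : cintegrable f ->
  cintegrable (fun x => c * f x) /\
  cintegral (fun x => c * f x) = c * cintegral f.
Proof.
case: c => u v [fr fi].
have ReE : (fun x => complex.Re ((u +i* v) * f x)) =
    (fun x => u * complex.Re (f x) - v * complex.Im (f x)).
  by apply/funext => x; case: (f x).
have ImE : (fun x => complex.Im ((u +i* v) * f x)) =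
    (fun x => u * complex.Im (f x) + v * complex.Re (f x)).
  by apply/funext => x; case: (f x).
have ur := integrableZl measurableT u fr; have ui := integrableZl measurableT u fi.
have vr := integrableZl measurableT v fr; have vi := integrableZl measurableT v fi.
rewrite /cintegrable /cintegral ReE ImE; split; first split.
- exact: (integrableB measurableT ur vi).
- exact: (integrableD measurableT ui vr).
- by rewrite RintegralB// RintegralD// !RintegralZl//; simpc.
Qed.

End complex_integral.

Section complex_gaussian.
Variable R : realType.
Implicit Types a s t x : R.
Local Notation mu := (@lebesgue_measure R).

(** Completing the square moves the center to m = s / (2 a), and the oscillating
    factor becomes cos (t (x - m) + (t m + phi)). *)
Lemma Rintegral_expR_cos a s t phi : 0 < a ->
  mu.-integrable [set: R] (EFin \o (fun x => expR (s * x - a * x ^+ 2) * cos (t * x + phi))) /\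
  \int[mu]_x (expR (s * x - a * x ^+ 2) * cos (t * x + phi)) =
  Num.sqrt (pi / a) *
    (expR ((s ^+ 2 - t ^+ 2) / (4 * a)) * cos (s * t / (2 * a) + phi)).
Proof.
move=> a0; pose m := s / (2 * a).
have an : a != 0 by rewrite gt_eqF.
have E : (fun x => expR (s * x - a * x ^+ 2) * cos (t * x + phi)) =
    (fun x => expR (s ^+ 2 / (4 * a)) *
       (gaussian a m x * cos (t * (x - m) + (s * t / (2 * a) + phi)))).
  apply/funext => x; rewrite /gaussian mulrA -expRD; congr (expR _ * cos _).
    by rewrite /m; field.
  by rewrite /m; field.
have ig : mu.-integrable [set: R] (EFin \o
    (fun x => gaussian a m x * cos (t * (x - m) + (s * t / (2 * a) + phi)))).
  exact: (integrable_gaussian_bounded m a0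
    (measurable_phase t m _ (continuous_measurable_fun (@continuous_cos R)))
    (fun x => norm_cos_le1 (t * (x - m) + (s * t / (2 * a) + phi)))).
rewrite E; split; first exact: (integrableZl measurableT _ ig).
rewrite RintegralZl// Rintegral_gaussian_cos// mulrCA; congr (_ * _).
rewrite mulrA -expRD; congr (expR _ * _).
by field.
Qed.

(** The imaginary part is the real-part formula with the phase shifted by
    - pi / 2. *)
Lemma cintegral_gaussian a (A : R[i]) : 0 < a ->
  cintegrable mu (fun x => expC (A * x%:C - (a * x ^+ 2)%:C)) /\
  cintegral mu (fun x => expC (A * x%:C - (a * x ^+ 2)%:C)) =
  (Num.sqrt (pi / a))%:C * expC (A ^+ 2 / (4 * a)%:C).
Proof.
case: A => s t a0.
have sinE u : sin u = cos (u + - (pi / 2)) :> R by rewrite cosB cos_pihalf sin_pihalf; ring.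
have [iR eR] := Rintegral_expR_cos s t 0 a0.
have [iI eI] := Rintegral_expR_cos s t (- (pi / 2)) a0.
have argE x : (s +i* t) * x%:C - (a * x ^+ 2)%:C = (s * x - a * x ^+ 2) +i* (t * x).
  by simpc.
have ReE : (fun x => complex.Re (expC ((s +i* t) * x%:C - (a * x ^+ 2)%:C))) =
    (fun x => expR (s * x - a * x ^+ 2) * cos (t * x + 0)).
  by apply/funext => x; rewrite argE addr0.
have ImE : (fun x => complex.Im (expC ((s +i* t) * x%:C - (a * x ^+ 2)%:C))) =
    (fun x => expR (s * x - a * x ^+ 2) * cos (t * x + - (pi / 2))).
  by apply/funext => x; rewrite argE -sinE.
rewrite /cintegrable /cintegral ReE ImE; split=> //.
rewrite eR eI -sinE addr0.
have -> : (s +i* t) ^+ 2 / (4 * a)%:C = ((s ^+ 2 - t ^+ 2) / (4 * a)) +i* (s * t / (2 * a)).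
  rewrite -fmorphV expr2; simpc; congr (_ +i* _).
  by field; rewrite gt_eqF.
by rewrite /expC /=; simpc.
Qed.

End complex_gaussian.

(** * Fubini for products of complex functions *)

Section fubini_product.
Context {d1 d2} {T1 : measurableType d1} {T2 : measurableType d2} {R : realType}.
Variable m1 : {sigma_finite_measure set T1 -> \bar R}.
Variable m2 : {sigma_finite_measure set T2 -> \bar R}.

Lemma integrable_mul_prod (f : T1 -> R) (g : T2 -> R) :
  m1.-integrable [set: T1] (EFin \o f) -> m2.-integrable [set: T2] (EFin \o g) ->
  (prod_measure m1 m2).-integrable [set: T1 * T2]
    (EFin \o (fun p => f p.1 * g p.2)).
Proof.
move=> fi gi; have /integrableP[/measurable_EFinP mf foo] := fi.
have /integrableP[/measurable_EFinP mg goo] := gi.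
apply/integrable12ltyP.
  apply/measurable_EFinP; apply: measurable_funM.
    exact: (measurableT_comp mf measurable_fst).
  exact: (measurableT_comp mg measurable_snd).
under eq_integral => x _.
  under eq_integral => y _ do rewrite /= normrM EFinM.
  rewrite ge0_integralZl//; last 1 first.
  - by apply/measurable_EFinP; exact: measurableT_comp.
  over.
rewrite ge0_integralZr//.
- by rewrite lte_mul_pinfty// ?integral_ge0// ge0_fin_numE// integral_ge0.
- by apply/measurable_EFinP; exact: measurableT_comp.
- by apply: integral_ge0.
Qed.

Lemma Rintegral_mul_prod (f : T1 -> R) (g : T2 -> R) :
  m1.-integrable [set: T1] (EFin \o f) -> m2.-integrable [set: T2] (EFin \o g) ->
  \int[prod_measure m1 m2]_p (f p.1 * g p.2) =
  (\int[m1]_x f x) * (\int[m2]_y g y).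
Proof.
move=> fi gi; have fgi := integrable_mul_prod fi gi.
have FE x : fubini_F m2 (EFin \o (fun p => f p.1 * g p.2)) x =
    ((f x)%:E * (\int[m2]_y g y)%:E)%E.
  rewrite /fubini_F fineK ?(integrable_fin_num measurableT gi)// -integralZl//.
rewrite {1}/Rintegral -(integral12_prod_meas1 fgi).
under eq_integral => x _ do rewrite FE.
by rewrite integralZr// -(fineK (integrable_fin_num measurableT fi)).
Qed.

Lemma cintegral_mul_prod (f : T1 -> R[i]) (g : T2 -> R[i]) :
  cintegrable m1 f -> cintegrable m2 g ->
  cintegrable (prod_measure m1 m2) (fun p => f p.1 * g p.2) /\
  cintegral (prod_measure m1 m2) (fun p => f p.1 * g p.2) =
  cintegral m1 f * cintegral m2 g.
Proof.
move=> [fr fi] [gr gi].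
have ReE : (fun p => complex.Re (f p.1 * g p.2)) = (fun p =>
    complex.Re (f p.1) * complex.Re (g p.2) - complex.Im (f p.1) * complex.Im (g p.2)).
  by apply/funext => p; case: (f p.1) => ? ?; case: (g p.2).
have ImE : (fun p => complex.Im (f p.1 * g p.2)) = (fun p =>
    complex.Re (f p.1) * complex.Im (g p.2) + complex.Im (f p.1) * complex.Re (g p.2)).
  by apply/funext => p; case: (f p.1) => ? ?; case: (g p.2).
have rr := integrable_mul_prod fr gr; have ii := integrable_mul_prod fi gi.
have ri := integrable_mul_prod fr gi; have ir := integrable_mul_prod fi gr.
rewrite /cintegrable /cintegral ReE ImE; split; first split.
- exact: (integrableB measurableT rr ii).
- exact: (integrableD measurableT ri ir).
- rewrite RintegralB// RintegralD// (Rintegral_mul_prod fr gr) (Rintegral_mul_prod fi gi).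
  by rewrite (Rintegral_mul_prod fr gi) (Rintegral_mul_prod fi gr); simpc.
Qed.

End fubini_product.

Section fubini_tuple.
Context {d} {T : measurableType d} {R : realType}.
Variable mu : {sigma_finite_measure set T -> \bar R}.

(** The measure on nonempty tuples is the image of a product measure under the
    bijection consing a head onto a tail, so functions are integrated through
    its inverse. *)
Lemma cons_measure_integral n (nu : {sigma_finite_measure set (n.-tuple T) -> \bar R})
    (h : T * n.-tuple T -> R) :
  (prod_measure mu nu).-integrable setT (EFin \o h) ->
  (cons_measure mu nu).-integrable setT
    (EFin \o (fun t => h (thead t, [tuple of behead t]))) /\
  \int[cons_measure mu nu]_t h (thead t, [tuple of behead t]) =
  \int[prod_measure mu nu]_p h p.
Proof.
move=> hi; have /integrableP[mh _] := hi.
pose uncons (t : n.+1.-tuple T) := (thead t, [tuple of behead t]).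
have muncons : measurable_fun [set: n.+1.-tuple T] uncons.
  by apply/measurable_fun_pair; [exact: measurable_tnth|exact: measurable_behead].
have consK : cancel (@tuple_cons _ T n) uncons.
  by move=> [x t]; rewrite /uncons theadE; congr pair; exact/val_inj.
have mF : measurable_fun setT (EFin \o h \o uncons) by exact: measurableT_comp.
have mc := @measurable_tuple_cons _ T n.
have hE : (EFin \o h \o uncons) \o @tuple_cons _ T n = EFin \o h.
  by apply/funext => p /=; rewrite consK.
have hi' : (prod_measure mu nu).-integrable (@tuple_cons _ T n @^-1` setT)
   ((EFin \o h \o uncons) \o @tuple_cons _ T n) by rewrite preimage_setT hE.
split; first exact: (integrable_pushforward mc mF hi' measurableT).
congr fine; have := integral_pushforward mc mF hi' measurableT.
by rewrite preimage_setT hE.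
Qed.

Lemma cintegral_dirac (c : R[i]) (t0 : T) :
  cintegrable \d_t0 (fun=> c) /\ cintegral \d_t0 (fun=> c) = c.
Proof.
have i0 (r : R) : (\d_t0).-integrable [set: T] (EFin \o (fun=> r)).
  apply/integrableP; split; first exact: measurable_cst.
  by rewrite integral_dirac// diracT mul1e ltry.
split=> //; case: c => u v.
by rewrite /cintegral /Rintegral !integral_dirac// !diracT !mul1e.
Qed.

End fubini_tuple.

Lemma cintegral_prod_tuple {d} {T : measurableType d} {R : realType}
    (mu : {sigma_finite_measure set T -> \bar R}) n (g : 'I_n -> T -> R[i]) :
  (forall i, cintegrable mu (g i)) ->
  cintegrable (tuple_measure mu n) (fun t => \prod_i g i (tnth t i)) /\
  cintegral (tuple_measure mu n) (fun t => \prod_i g i (tnth t i)) =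
  \prod_i cintegral mu (g i).
Proof.
elim: n g => [|n IH] g gi.
  rewrite big_ord0 (_ : (fun t => _) = fun=> 1); first exact: cintegral_dirac.
  by apply/funext => t; rewrite big_ord0.
have [ih1 ih2] := IH _ (fun i => gi (lift ord0 i)).
have [[p1 p2] pE] := cintegral_mul_prod (gi ord0) ih1.
have gE : (fun t : n.+1.-tuple T => \prod_i g i (tnth t i)) = (fun t =>
    g ord0 (thead t) * \prod_i g (lift ord0 i) (tnth [tuple of behead t] i)).
  apply/funext => t; case/tupleP: t => x t.
  rewrite big_ord_recl tnth0 theadE; congr (_ * _); apply: eq_bigr => i _.
  by rewrite tnthS; congr (g _ (tnth _ _)); exact/val_inj.
rewrite gE big_ord_recl -ih2 -pE /=.
have [r1 r2] := cons_measure_integral p1.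
have [i1 i2] := cons_measure_integral p2.
by split; [split|congr (_ +i* _)].
Qed.

(** * The reproducing property *)

Section reproducing.
Variables (R : realType) (alpha : {posnum R}) (n : nat).
Local Notation Cn := 'cV[R[i]]_n.
Local Notation a := (alpha%:num).
Implicit Types (u w z : Cn).

Lemma conj_expC (z : R[i]) : ((expC z)^* = expC (z^*))%R.
Proof. by case: z => x y; rewrite /expC/= cosN sinN mulrN. Qed.

Lemma expC_real (x : R) : expC x%:C = (expR x)%:C.
Proof. by rewrite /expC/= cos0 sin0 mulr1 mulr0. Qed.

(** One complex coordinate z = p.1 + i p.2 of the integrand of <k_u, k_w>,
    normalized density included: the exponent alpha (z conj(u) + conj(z) w) -
    alpha |z|^2 is split into its parts in p.1 and p.2. *)
Definition kernel_pair_density (u w : R[i])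
    (p : measurableTypeR R * measurableTypeR R) : R[i] :=
  (a / pi)%:C *
  (expC (a%:C * (u^* + w) * p.1%:C - (a * p.1 ^+ 2)%:C) *
   expC (a%:C * (u^* - w) * 'i * p.2%:C - (a * p.2 ^+ 2)%:C)).

(** With A = alpha (conj(u) + w) and B = i alpha (conj(u) - w), the two
    one-dimensional Gaussians contribute A^2 + B^2 = 4 alpha^2 w conj(u) to the
    exponent, and sqrt (pi / alpha) twice cancels the normalization. *)
Lemma cintegral_kernel_pair_density (u w : R[i]) :
  cintegrable (prod_measure lebesgue_measure lebesgue_measure)
    (kernel_pair_density u w) /\
  cintegral (prod_measure lebesgue_measure lebesgue_measure)
    (kernel_pair_density u w) = expC (a%:C * (w * u^*)).
Proof.
have a0 : 0 < a by [].
have an : a != 0 by rewrite gt_eqF.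
have [iA eA] := cintegral_gaussian (a%:C * (u^* + w)) a0.
have [iB eB] := cintegral_gaussian (a%:C * (u^* - w) * 'i) a0.
have [iAB eAB] := cintegral_mul_prod iA iB.
have [i e] := cintegralZl (a / pi)%:C iAB.
split=> //; rewrite e eAB eA eB mulrACA -expCD [LHS]mulrA -!rmorphM/=.
rewrite -expr2 sqr_sqrtr ?divr_ge0 ?pi_ge0// mulf_div [pi * _]mulrC divff; last first.
  by rewrite mulf_neq0// gt_eqF// pi_gt0.
rewrite mul1r; congr expC.
rewrite [in X in X + _]exprMn exprMn sqr_i rmorphM/= rmorph_nat.
have aC : a%:C != 0 :> R[i] by rewrite fmorph_eq0.
by field.
Qed.

Lemma kernel_product_density u w (x : n.-tuple (measurableTypeR R * measurableTypeR R)) :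
  let z := Cn_of_tuple x in
  kernel_fun alpha u z * (kernel_fun alpha w z)^* * (gauss_density alpha z)%:C =
  \prod_j kernel_pair_density (u j 0) (w j 0) (tnth x j).
Proof.
move=> z; rewrite /kernel_pair_density big_split/= prodr_const card_ord -rmorphXn.
under [X in _ = _ * X]eq_bigr do rewrite -expCD.
rewrite -expC_sum /kernel_fun conj_expC.
rewrite /gauss_density [(_ * expR _)%:C]rmorphM /= -expC_real mulrCA -!expCD.
congr (_ * expC _).
rewrite /dotC rmorphM/= rmorph_sum/= mulr_sumr mulr_sumr.
rewrite (_ : (- a * complex.Re (\sum_i z i 0 * (z i 0)^*))%:C =
   \sum_i (- a * complex.Re (z i 0 * (z i 0)^*))%:C); last first.
  by rewrite raddf_sum mulr_sumr rmorph_sum.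
rewrite -!big_split/=; apply: eq_bigr => j _; rewrite /z mxE.
case: (tnth x j) => p q; case: (u j 0) => u1 u2; case: (w j 0) => w1 w2 /=.
by simpc; congr (_ +i* _); ring.
Qed.

(** The reproducing formula <k_u, k_w> = k_u(w), proved for kernels only; the
    scalar c accommodates normalized kernels. *)
Lemma gauss_integral_kernel (c : R[i]) u w :
  gauss_integral alpha (fun z => c * (kernel_fun alpha u z * (kernel_fun alpha w z)^*)) =
  c * kernel_fun alpha u w.
Proof.
have gi j := cintegral_kernel_pair_density (u j 0) (w j 0).
have [ig eg] := cintegral_prod_tuple (fun j => (gi j).1).
have [icg ecg] := cintegralZl c ig.
have fE x : c * (kernel_fun alpha u (Cn_of_tuple x) *
       (kernel_fun alpha w (Cn_of_tuple x))^*) * (gauss_density alpha (Cn_of_tuple x))%:C =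
     c * \prod_j kernel_pair_density (u j 0) (w j 0) (tnth x j).
  by rewrite -mulrA kernel_product_density.
have cf : cintegral (volume R n) (fun x => c * \prod_j kernel_pair_density (u j 0) (w j 0) (tnth x j)) = c * kernel_fun alpha u w.
  rewrite /volume ecg eg; congr (_ * _).
  under eq_bigr do rewrite (gi _).2.
  by rewrite -expC_sum -mulr_sumr.
rewrite -cf /gauss_integral /cintegral.
have ReM (t : R) (v : R[i]) : complex.Re v * t = complex.Re (v * t%:C).
  by case: v => p q /=; rewrite mulr0 subr0.
have ImM (t : R) (v : R[i]) : complex.Im v * t = complex.Im (v * t%:C).
  by case: v => p q /=; rewrite mulr0 add0r.
by congr (_ +i* _); apply: eq_Rintegral => x _; rewrite -fE ?ReM ?ImM.
Qed.

End reproducing.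

(** * The Berezin range of a linear symbol *)

Section berezin.
Variables (R : realType) (alpha : {posnum R}) (n : nat).
Local Notation Cn := 'cV[R[i]]_n.
Local Notation a := (alpha%:num).
Implicit Types (w z : Cn) (A : 'M[R[i]]_n).

Lemma dotC_adjoint A z w :
  dotC (A *m z) w = dotC z (map_mx Num.conj A^T *m w).
Proof.
rewrite /dotC; under eq_bigr do rewrite mxE mulr_suml.
rewrite exchange_big; apply: eq_bigr => j _ /=.
rewrite mxE rmorph_sum mulr_sumr; apply: eq_bigr => i _.
by rewrite !mxE rmorphM/= conjCK mulrCA mulrA.
Qed.

Lemma dotC_self w : dotC w w = (complex.Re (dotC w w))%:C.
Proof.
rewrite /dotC raddf_sum rmorph_sum; apply: eq_bigr => i _.
by case: (w i 0) => x y /=; simpc; congr (_ +i* _); ring.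
Qed.

Lemma fock_norm_kernel w :
  fock_norm (Defs.kernel alpha w) = Num.sqrt (expR (a * complex.Re (dotC w w))).
Proof.
rewrite /fock_norm.
have -> : inner (Defs.kernel alpha w) (Defs.kernel alpha w) = kernel_fun alpha w w.
  rewrite -[RHS]mul1r -gauss_integral_kernel; congr gauss_integral.
  by apply/funext => z; rewrite mul1r.
have aE : a%:C * dotC w w = (a * complex.Re (dotC w w))%:C.
  by rewrite [in LHS]dotC_self rmorphM.
by rewrite /kernel_fun aE expC_real.
Qed.

(** Composition sends k_w to the kernel at the adjoint image of w, which lies in
    the Fock space for every matrix A: on kernels the operator is never in its
    default case. *)
Lemma composition_operator_normalized_kernel A w :
  composition_operator alpha (fun z => A *m z) (normalized_kernel alpha w) =
  (fun z => ((fock_norm (Defs.kernel alpha w))^-1)%:C *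
            kernel_fun alpha (map_mx Num.conj A^T *m w) z) :> (Cn -> R[i]).
Proof.
set c := ((fock_norm _)^-1)%:C.
have E : normalized_kernel alpha w \o (fun z => A *m z) =
    (fun z => c * kernel_fun alpha (map_mx Num.conj A^T *m w) z).
  by apply/funext => z; rewrite /= /kernel_fun dotC_adjoint.
rewrite /composition_operator; case: pselect => [h|[]]; first exact: E.
rewrite E; split.
  exact: scale_kernel_holomorphic.
exact: scale_kernel_square_integrable.
Qed.

Lemma berezin_linear A w :
  inner (composition_operator alpha (fun z => A *m z) (normalized_kernel alpha w))
    (normalized_kernel alpha w) =
  expC (a%:C * (dotC (A *m w) w - dotC w w)).
Proof.
rewrite /inner composition_operator_normalized_kernel /=.
set v := map_mx _ _ *m w; set c := (fock_norm _)^-1.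
have -> : (fun z => c%:C * kernel_fun alpha v z * (c%:C * kernel_fun alpha w z)^*)%R =
    (fun z => (c ^+ 2)%:C * (kernel_fun alpha v z * (kernel_fun alpha w z)^*))%R.
  apply/funext => z; rewrite rmorphM/= mulrACA; congr (_ * _).
  by rewrite [(c%:C)^*%R]conjc_real -rmorphM -expr2.
rewrite gauss_integral_kernel /c fock_norm_kernel exprVn sqr_sqrtr ?expR_ge0//.
rewrite -expRN -expC_real -expCD dotC_adjoint -/v; congr expC.
by rewrite mulrBr addrC [in RHS]dotC_self -rmorphM/= rmorphN.
Qed.

Lemma dotC_diag_perturbation (k : 'I_n) (l : R[i]) w :
  let A := diag_mx (\row_j (if j == k then l else 1)) in
  dotC (A *m w) w - dotC w w = (l - 1) * (w k 0 * (w k 0)^*)%R.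
Proof.
rewrite /= mul_diag_mx /dotC -sumrB (bigD1 k)//= big1 => [|i ik].
  by rewrite addr0 !mxE eqxx; ring.
by rewrite !mxE (negbTE ik) mul1r subrr.
Qed.

(** The parameter r is alpha |w_k|^2; a vector with entry sqrt (r / alpha) at k
    reaches every r >= 0. *)
Lemma berezin_range_diag (k : 'I_n) (l : R[i]) :
  let A := diag_mx (\row_j (if j == k then l else 1)) in
  berezin_range (composition_operator alpha (fun z => A *m z)) =
  [set expC ((l - 1) * r%:C) | r in [set r : R | 0 <= r]].
Proof.
move=> A; apply/seteqP; split => [_ [w _ <-]|_ [r /= r0 <-]].
  case E : (w k 0) => [x y]; exists (a * (x ^+ 2 + y ^+ 2)).
    by rewrite /= mulr_ge0// addr_ge0// sqr_ge0.
  rewrite berezin_linear dotC_diag_perturbation E mulrCA; congr (expC (_ * _)).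
  by simpc; congr (_ +i* _); ring.
exists (\col_j (Num.sqrt (r / a))%:C) => //.
rewrite berezin_linear dotC_diag_perturbation mxE mulrCA [(_%:C)^*%R]conjc_real.
congr (expC (_ * _)); rewrite -!rmorphM/= -expr2 sqr_sqrtr ?divr_ge0//.
by rewrite mulrC divfK.
Qed.

End berezin.

(** * Convexity of exponential curves *)

Section convexity.
Variable R : realType.

Lemma expC_neq0 (z : R[i]) : expC z != 0.
Proof.
apply/eqP => z0; have := normc_expC z; rewrite z0 Normc.normc0 => /esym/eqP.
by rewrite gt_eqF// expR_gt0.
Qed.

Lemma conv_Rcomplex_real (t : {i01 R}) (x y : R) :
  conv t (x%:C : convex_lmodType (Rcomplex R)) (y%:C : convex_lmodType (Rcomplex R)) =
  (t%:num * x + (1 - t%:num) * y)%:C :> Rcomplex R.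
Proof. by congr (_ +i* _); rewrite /= !mulr0 addr0. Qed.

(** A nonreal direction makes the curve wind around 0 through points 1 and -e,
    so that convexity would force the value 0; a real direction gives an
    interval of positive reals with endpoint 1. *)
Lemma convex_expC_ray (c : R[i]) :
  convex_set ([set expC (c * r%:C) | r in [set r : R | 0 <= r]] : set (Rcomplex R)) <->
  complex.Im c = 0.
Proof.
case: c => a b; split=> /=.
  move=> cvx; apply/eqP/negPn/negP => b0.
  (* half a turn *)
  pose r := pi / `|b|.
  pose e := expR (a * r).
  have e0 : 0 < e by exact: expR_gt0.
  pose S : set (Rcomplex R) := [set expC ((a +i* b) * r%:C) | r in [set r : R | 0 <= r]].
  have S1 : (1 : R[i]) \in S.
    by rewrite inE; exists 0 => //=; rewrite mulr0 expC_real expR0.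
  have Se : ((- e)%:C : R[i]) \in S.
    rewrite inE; exists r; first by rewrite /r /= divr_ge0 ?pi_ge0.
    have -> : (a +i* b) * r%:C = (a * r) +i* (b * r) by simpc.
    rewrite /expC/= -/e.
    have [bp|bn] : b * r = pi \/ b * r = - pi.
      rewrite /r; case: (ltrgt0P b) b0 => // bs _; [left|right].
        by rewrite mulrCA mulfV ?mulr1// gt_eqF.
      by rewrite invrN mulrN mulrN mulrCA mulfV ?mulr1// lt_eqF.
    - by rewrite bp cospi sinpi mulr0 mulrN1.
    - by rewrite bn cosN sinN cospi sinpi oppr0 mulr0 mulrN1.
  (* e / (1 + e) is the weight at which the segment from 1 to -e meets 0 *)
  have d0 : 0 < 1 + e by rewrite addr_gt0.
  have t0 : 0 <= e / (1 + e) by rewrite divr_ge0// ltW.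
  have t1 : e / (1 + e) <= 1 by rewrite ler_pdivrMr// mul1r lerDr.
  have := cvx _ _ (Itv01 t0 t1) S1 Se.
  rewrite inE => -[u _ ]; rewrite (conv_Rcomplex_real _ 1) /= => /eqP.
  rewrite mulrN mulr1 (_ : _ + _ = 0); first by rewrite (negPf (expC_neq0 _)).
  by field; rewrite gt_eqF.
move=> b0; rewrite b0 => x y t.
have argE r : (a +i* 0) * r%:C = (a * r)%:C by simpc.
rewrite !inE => -[r1 /= r10 <-] [r2 /= r20 <-]; rewrite !argE !expC_real.
rewrite conv_Rcomplex_real; set p := _ + _.
have t0 : 0 <= t%:num by [].
have t1 : t%:num <= 1 by [].
have e1 := expR_gt0 (a * r1); have e2 := expR_gt0 (a * r2).
have [a0|a0|a0] := ltgtP a 0.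
- have h1 : expR (a * r1) <= 1 by rewrite -expR0 ler_expR; nra.
  have h2 : expR (a * r2) <= 1 by rewrite -expR0 ler_expR; nra.
  have p0 : 0 < p by rewrite /p; nra.
  have p1 : p <= 1 by rewrite /p; nra.
  exists (ln p / a) => /=; last by rewrite argE mulrCA mulfV ?lt_eqF// mulr1 expC_real lnK.
  by rewrite -mulrNN -invrN mulr_ge0 ?invr_ge0 ?oppr_ge0 ?ln_le0 ?(ltW a0).
- have h1 : 1 <= expR (a * r1) by rewrite -expR0 ler_expR; nra.
  have h2 : 1 <= expR (a * r2) by rewrite -expR0 ler_expR; nra.
  have p1 : 1 <= p by rewrite /p; nra.
  have p0 : 0 < p by exact: lt_le_trans p1.
  exists (ln p / a) => /=; last by rewrite argE mulrCA mulfV ?gt_eqF// mulr1 expC_real lnK.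
  by rewrite divr_ge0 ?ln_ge0// ltW.
- exists 0 => //=.
  by rewrite argE mulr0 expC_real /p a0 !mul0r expR0 !mulr1 addrC subrK.
Qed.
End convexity.

Theorem theorem4p16 (R : realType) (alpha : {posnum R}) (n : nat)
    (n_gt0 : (0 < n)%N) (k : 'I_n) (a b : R) (hab : a ^+ 2 + b ^+ 2 <= 1) :
  let A : 'M[R[i]]_n := diag_mx (\row_j (if j == k then a +i* b else 1)) in
  let C_phi := composition_operator alpha (fun z : 'cV[R[i]]_n => A *m z) in
  convex_set (berezin_range C_phi : set (Rcomplex R)) <-> b = 0.
Proof.
move=> A C_phi; rewrite /C_phi berezin_range_diag.
have := convex_expC_ray ((a +i* b) - 1).
by rewrite (_ : complex.Im _ = b) //= subr0.
Qed.
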